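(* Let $X\subset\mathbb{R}^n$ and $S\subset X$ be nonempty semi-algebraic sets, let $f_0\colon X\to\mathbb{R}$ be a Lipschitz function (not necessarily semi-algebraic) with $\inf_{x\in S}f_0(x)$ finite, and let $\psi\colon\mathbb{R}^n\to\mathbb{R}_+$ be a semi-algebraic residual function for $S$. Assume that (A1) for any sequence of points $x_k$ in $X$, if $\psi(x_k)\to0$, then $\mathrm{dist}(x_k,S)\to0$; (A2) the distance function $\mathrm{dist}(\cdot,S)$ is bounded from above on $X$. Then there exist constants $c_*>0$ and $\alpha\in(0,1]$ such that for all $c>c_*$, $$\inf_{x\in S}f_0(x)=\inf_{x\in X}\{f_0(x)+c\,[\psi(x)]^\alpha\},\qquad \mathrm{argmin}_S f_0(x)=\mathrm{argmin}_X\{f_0(x)+c\,[\psi(x)]^\alpha\}.$$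
   Context: $\mathbb{R}_+ := [0,\infty)$; $\mathrm{dist}(x,S):=\inf_{x'\in S}\|x-x'\|$ with the Euclidean norm. A subset of $\mathbb{R}^n$ is semi-algebraic if it is a finite union of sets each defined by finitely many polynomial equations and strict inequalities; a function is semi-algebraic if its graph is semi-algebraic. A residual function of $S$ is a function $\psi\colon\mathbb{R}^n\to\mathbb{R}_+$ such that $\psi(x)=0$ if and only if $x\in S$. $f_0$ is Lipschitz on $X$ if there is $L>0$ with $|f_0(x)-f_0(x')|\le L\|x-x'\|$ for all $x,x'\in X$. $\mathrm{argmin}$ denotes the set of points of the indicated set at which the (finite) infimum is attained (possibly empty). *)

(* Defs.v *)
From HB Require Import structures.
From mathcomp Require Import all_boot all_order all_algebra.
From mathcomp Require Import all_classical all_reals all_analysis.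
(* [mpoly] is not imported: its notations clash with those of analysis. *)
From mathcomp Require mpoly.

Set Implicit Arguments.
Unset Strict Implicit.
Unset Printing Implicit Defensive.

Import Order.TTheory GRing.Theory Num.Theory.
Import numFieldNormedType.Exports.

Local Open Scope classical_set_scope.
Local Open Scope ring_scope.

(* Finite unions of sets cut out by finitely many polynomial equations and
   strict inequalities: each element [(eqs, pos)] of the family [F] stands for
   the set of the [x] with [p(x) = 0] for [p] in [eqs] and [q(x) > 0] for [q] in
   [pos]. *)
Definition semialgebraic_set (R : realType) (n : nat) (A : set 'rV[R]_n) : Prop :=
  exists F : seq (seq (mpoly.mpoly n R) * seq (mpoly.mpoly n R)),
    A = [set x : 'rV[R]_n |
          has (fun B => all (fun p => mpoly.meval (x ord0) p == 0) B.1 &&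
                        all (fun q => 0 < mpoly.meval (x ord0) q) B.2) F].

Definition graph (R : realType) (n : nat) (f : 'rV[R]_n -> R) :
    set 'rV[R]_(n + 1) :=
  [set row_mx x (f x)%:M | x in [set: 'rV[R]_n]].

Definition semialgebraic_fun (R : realType) (n : nat) (f : 'rV[R]_n -> R) : Prop :=
  semialgebraic_set (graph f).

(* The library norm [`|x|] of a matrix is the sup norm. *)
Definition enorm (R : realType) (n : nat) (x : 'rV[R]_n) : R :=
  Num.sqrt (\sum_(i < n) x ord0 i ^+ 2).

(* The infimum is that of a set of nonnegative reals; it is meaningful only for
   nonempty [S], since [inf set0 = 0]. *)
Definition dist (R : realType) (n : nat) (x : 'rV[R]_n) (S : set 'rV[R]_n) : R :=
  inf [set enorm (x - y) | y in S].

Definition elipschitz_on (R : realType) (n : nat) (X : set 'rV[R]_n)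
    (f : 'rV[R]_n -> R) : Prop :=
  exists2 L : R, 0 < L &
    forall x y, X x -> X y -> `|f x - f y| <= L * enorm (x - y).

Definition residual_fun (R : realType) (n : nat) (S : set 'rV[R]_n)
    (psi : 'rV[R]_n -> R) : Prop :=
  (forall x, 0 <= psi x) /\ (forall x, psi x = 0 <-> S x).

(* Taken in [\bar R], since the real-valued [inf] is 0 on sets that are not
   bounded below. *)
Definition inf_on (R : realType) (T : Type) (A : set T) (f : T -> R) : \bar R :=
  ereal_inf [set (f x)%:E | x in A].

Definition argmin_on (R : realType) (T : Type) (A : set T) (f : T -> R) : set T :=
  [set x | A x /\ (f x)%:E = inf_on A f].

(* Main.v *)
Require Import Defs.
From HB Require Import structures.
From mathcomp Require Import all_boot all_order all_algebra.
From mathcomp Require Import all_classical all_reals all_analysis.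
From mathcomp Require Import lra.
From mathcomp Require ordered_qelim qe_rcf.

Set Implicit Arguments.
Unset Strict Implicit.
Unset Printing Implicit Defensive.

Import Order.TTheory GRing.Theory Num.Theory.
Import numFieldNormedType.Exports.

Local Open Scope classical_set_scope.
Local Open Scope ring_scope.

(** The penalty is exact because of a Hölderian error bound: there are [C > 0]
    and [alpha] in [(0, 1]] with [dist x S <= C * psi x `^ alpha] for all [x] in
    [X] ([holder_error_bound]).  If [f0] has Lipschitz constant [L], then
    [inf_S f0 <= f0 x + L * dist x S <= f0 x + L * C * psi x `^ alpha] on [X];
    so the two infima agree as soon as [c >= L * C], and for [c > L * C] a
    minimizer of the penalized function must satisfy [psi x = 0]
    ([exact_penalty]).

    For the error bound, let [theta r] be the infimum of [psi] over the points
    of [X] at distance at least [r] from [S], for [r > 0].  It is positive: a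
    sequence of such points with [psi] tending to 0 would contradict [A1].  The
    pairs [(t, r)] such that [psi] takes the value [t] at one of these points
    form a first-order definable set ([definable_far_values]), so quantifier
    elimination over the reals describes it by the signs of finitely many
    nonzero polynomials [p] in two variables ([definable_same_signs]).  The
    number [theta r] lies on the boundary of the fiber over [r], where one of
    these polynomials must vanish: [p (theta r) r = 0] ([inf_root]).

    A nonzero polynomial [p] can vanish at points [(t, r)] with [t > 0] and [r]
    small only if [t >= c * r ^+ m] ([curve_lower_bound]): divide [p] by the
    largest power of [t], which leaves [b r + t * h (t, r) = 0] with [b] a
    nonzero polynomial; near 0, [b] is bounded below by a power of [r] while [h]
    is bounded.  Hence [theta r >= c * r ^+ m] for small [r]
    ([residual_lower_bound]).  Under [A2], distances to [S] can be scaled down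
    into the range of those [r] at the price of a constant factor, and taking
    roots gives the error bound on all of [X]. *)

(** * Lower bounds for polynomials near the origin *)

Lemma poly_bounded (R : realType) (p : {poly R}) :
  exists2 K : R, 0 <= K & forall x, 0 <= x <= 1 -> `|p.[x]| <= K.
Proof.
elim/poly_ind: p => [|p a [K K0 pK]].
  by exists 0 => // x _; rewrite horner0 normr0.
exists (K + `|a|) => [|x /andP[x0 x1]]; first exact: addr_ge0.
rewrite !hornerE; apply: le_trans (ler_normD _ _) _; rewrite lerD2r normrM.
rewrite -[leRHS]mulr1 ler_pM ?pK ?x0 //.
by rewrite ger0_norm.
Qed.

Lemma bipoly_bounded (R : realType) (p : {poly {poly R}}) :
  exists2 K : R, 0 <= K &
    forall t r, 0 <= t <= 1 -> 0 <= r <= 1 -> `|p.[t, r]| <= K.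
Proof.
elim/poly_ind: p => [|p a [K K0 pK]].
  by exists 0 => // t r _ _; rewrite !horner0 normr0.
have [L L0 aL] := poly_bounded a.
exists (K + L) => [|t r tI rI]; first exact: addr_ge0.
rewrite !hornerE; apply: le_trans (ler_normD _ _) _.
rewrite lerD ?aL // normrM -[leRHS]mulr1 ler_pM ?pK //.
by case/andP: tI => t0 t1; rewrite ger0_norm.
Qed.

(** Near 0 a nonzero polynomial behaves like its term of lowest degree, whose
    exponent is the order [m] of the root 0. *)
Lemma poly_lower_bound (R : realType) (p : {poly R}) : p != 0 ->
  exists (c : R) (m : nat) (d : R),
    [/\ 0 < c, 0 < d <= 1 & forall x, 0 < x < d -> c * x ^+ m <= `|p.[x]|].
Proof.
have [m [q]] := multiplicity_XsubC p 0.
rewrite /root => + pE p0; rewrite p0 /= => q0.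
have [u [a]] : exists (u : {poly R}) (a : R), q = u * 'X + a%:P.
  elim/poly_ind: (q) => [|u a _]; first by exists 0, 0; rewrite mul0r addr0.
  by exists u, a.
move=> qE; have a0 : a != 0 by move: q0; rewrite qE !hornerE.
have [K K0 uK] := poly_bounded u.
have a2 : 0 < `|a| / 2 by rewrite divr_gt0 ?normr_gt0.
have K1 : 0 < K + 1 by rewrite ltr_wpDl.
exists (`|a| / 2), m, (Num.min 1 (`|a| / 2 / (K + 1))); split=> //.
  by rewrite lt_min ltr01 divr_gt0 //= ge_min lexx.
move=> x /andP[x0]; rewrite lt_min ltr_pdivlMr // => /andP[x1 xa].
rewrite pE qE subr0 !hornerE normrM.
rewrite (ger0_norm (exprn_ge0 _ (ltW x0))) ler_wpM2r ?exprn_ge0 ?(ltW x0) //.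
have ux : `|u.[x] * x| <= `|a| / 2.
  rewrite normrM (ger0_norm (ltW x0)).
  have : `|u.[x]| <= K by apply: uK; rewrite !ltW.
  by move: x0 xa; set b := `|a|; set v := `|_|; nra.
have := lerB_normD a (u.[x] * x); rewrite [u.[x] * x + a]addrC.
by move: ux; set b := `|a|; set v := `|_ * _|; set w := `|_ + _|; lra.
Qed.

(** Once the largest power of the outer variable [t] is divided out of [p], the
    relation reads [b r + t * h (t, r) = 0] with [b] a nonzero polynomial: [t]
    is at least [`|b r|] divided by a bound on [h]. *)
Lemma curve_lower_bound (R : realType) (p : {poly {poly R}}) : p != 0 ->
  exists (c : R) (m : nat) (d : R),
    [/\ 0 < c, 0 < d <= 1 & forall t r, 0 < t -> 0 < r < d ->
      p.[t, r] = 0 -> c * r ^+ m <= t].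
Proof.
have [k [q]] := multiplicity_XsubC p 0.
rewrite /root => + pE p0; rewrite p0 /= => q0.
have [h [b]] : exists (h : {poly {poly R}}) (b : {poly R}), q = h * 'X + b%:P.
  elim/poly_ind: (q) => [|u a _]; first by exists 0, 0; rewrite mul0r addr0.
  by exists u, a.
move=> qE; have b0 : b != 0 by move: q0; rewrite qE !hornerE.
have [c [m [d [c0 /andP[d0 d1] bc]]]] := poly_lower_bound b0.
have [K K0 hK] := bipoly_bounded h.
(* The summand [c + 1] makes [c / (c + K + 1)] less than 1, which settles the
   case [1 <= t], where [h] is not controlled. *)
have M0 : 0 < c + K + 1 by lra.
exists (c / (c + K + 1)), m, d; split; rewrite ?divr_gt0 ?d0 // => t r t0 rd.
have /andP[r0 rd'] := rd.
have r1 : r < 1 by lra.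
have rm0 : 0 <= r ^+ m by apply/exprn_ge0/ltW.
have rm1 : r ^+ m <= 1 by rewrite exprn_ile1 // ltW.
rewrite mulrAC ler_pdivrMr // pE qE subr0 !hornerE.
move=> /eqP; rewrite mulf_eq0 (expf_eq0 t) (gt_eqF t0) andbF orbF.
rewrite addrC addr_eq0 => /eqP bE.
have [t1|t1] := lerP 1 t; first by nra.
have := bc r rd; rewrite bE normrN normrM (gtr0_norm t0).
have : `|h.[t, r]| <= K by apply: hK; lra.
by set v := `|_|; nra.
Qed.

Lemma curves_lower_bound (R : realType) (ps : seq {poly {poly R}}) :
  (forall p, p \in ps -> p != 0) ->
  exists (c : R) (m : nat) (d : R),
    [/\ 0 < c, 0 < d <= 1 & forall p t r, p \in ps -> 0 < t -> 0 < r < d ->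
      p.[t, r] = 0 -> c * r ^+ m <= t].
Proof.
elim: ps => [|p ps IH] ps0.
  by exists 1, 0%N, 1; split=> //; rewrite ltr01 lexx.
have [|c1 [m1 [d1 [c10 /andP[d10 d11] H1]]]] := IH.
  by move=> q qps; apply: ps0; rewrite inE qps orbT.
have [|c2 [m2 [d2 [c20 /andP[d20 d21] H2]]]] := @curve_lower_bound R p.
  by apply: ps0; rewrite mem_head.
(* Since [r < 1], raising the exponent only weakens the bound. *)
exists (Num.min c1 c2), (m1 + m2)%N, (Num.min d1 d2); split.
- by rewrite lt_min c10.
- by rewrite lt_min d10 d20 ge_min d11.
move=> q t r + t0 /andP[r0]; rewrite lt_min => + /andP[rd1 rd2].
have rI k : 0 <= r ^+ k <= 1.
  by rewrite exprn_ge0 ?exprn_ile1 ?(ltW r0) //; lra.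
rewrite inE => /predU1P[->|qps] q0.
  apply: le_trans (H2 t r t0 _ q0); last by rewrite r0.
  apply: ler_pM => //; rewrite ?exprn_ge0 ?(ltW r0) ?ge_min ?lexx ?orbT //.
    by rewrite le_min !ltW.
  by rewrite exprD; move: (rI m1) (rI m2) => /andP[? ?] /andP[? ?]; nra.
apply: le_trans (H1 q t r qps t0 _ q0); last by rewrite r0.
apply: ler_pM => //; rewrite ?exprn_ge0 ?(ltW r0) ?ge_min ?lexx ?orbT //.
  by rewrite le_min !ltW.
by rewrite exprD; move: (rI m1) (rI m2) => /andP[? ?] /andP[? ?]; nra.
Qed.

(** * Signs of polynomials at the boundary of a set *)

Lemma poly_sgr_near (R : realType) (q : {poly R}) (t : R) : q.[t] != 0 ->
  \forall s \near t, Num.sg q.[s] = Num.sg q.[t].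
Proof.
move=> qt0; have q_cvg : q.[s] @[s --> t] --> q.[t] by exact: continuous_horner.
case: (ltgtP q.[t] 0) (qt0) => // [qt_lt0|qt_gt0] _.
  near=> s; rewrite !ltr0_sg //; near: s; exact: (cvgr_lt _ q_cvg).
near=> s; rewrite !gtr0_sg //; near: s; exact: (cvgr_gt _ q_cvg).
Unshelve. all: by end_near. Qed.

Lemma horner2_map (R : realType) (p : {poly {poly R}}) (t r : R) :
  p.[t, r] = (map_poly (horner_eval r) p).[t].
Proof. by rewrite -[t in RHS](hornerC t r) horner_map. Qed.

Definition same_signs (R : realType) (ps : seq {poly {poly R}}) (t1 t2 r : R) :=
  forall p, p \in ps -> Num.sg p.[t1, r] = Num.sg p.[t2, r].

(** If no polynomial of the family vanished at [inf A], none would change sign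
    near it, so [A] would contain points on both sides of its infimum or none
    on either side. *)
Lemma inf_root (R : realType) (ps : seq {poly {poly R}}) (r : R) (A : set R) :
  A !=set0 -> has_lbound A ->
  (forall t1 t2, same_signs ps t1 t2 r -> A t1 -> A t2) ->
  exists2 p, p \in ps & p.[inf A, r] = 0.
Proof.
move=> A0 lbA signA; apply: contrapT => no_root.
have : \forall s \near inf A,
    forall p, p \in ps -> Num.sg p.[s, r] = Num.sg p.[inf A, r].
  have : forall p, p \in ps -> p.[inf A, r] != 0.
    by move=> p pps; apply/eqP => p0; apply: no_root; exists p.
  elim: (ps) => [|p qs IH] nz; first by near=> s => q; rewrite in_nil.
  have := @poly_sgr_near _ (map_poly (horner_eval r) p) (inf A).
  rewrite -horner2_map => /(_ (nz p (mem_head _ _))) near_p.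
  have near_qs := IH (fun q qin => nz q (mem_behead (s := p :: qs) qin)).
  near=> s => q; rewrite inE => /predU1P[->|].
    by rewrite !horner2_map; near: s; move: near_p; rewrite !horner2_map.
  by move: q; near: s.
move=> /nbhs_ballP[e /= e0 eP].
have e2 : 0 < e / 2 by rewrite divr_gt0.
have [t At tA] := inf_adherent e0 (conj A0 lbA).
suff Ae : A (inf A - e / 2) by have := ge_inf lbA Ae; lra.
have infA_t : inf A <= t by exact: ge_inf.
apply: signA At => p pps; rewrite !(eP _ _ p pps) //= /ball /=.
  by rewrite opprB addrC subrK gtr0_norm // gtr_pMr // invf_lt1 // ltr1n.
by rewrite distrC ger0_norm; lra.
Unshelve. all: by end_near. Qed.

(** * First-order definable sets *)

Import ordered_qelim.

(** Assignments are total functions [nat -> R], although formulas are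
    interpreted over finite sequences: this makes updating an assignment an
    operation on functions, insensitive to the length of the sequence. *)
Definition definable (R : realType) (P : (nat -> R) -> Prop) : Prop :=
  exists f : ord.formula R, forall e : seq R, ord.holds e f <-> P (nth 0 e).

Definition definable_term (R : realType) (F : (nat -> R) -> R) : Prop :=
  exists t : GRing.term R, forall e : seq R, GRing.eval e t = F (nth 0 e).

Lemma definable_term_var (R : realType) (i : nat) :
  definable_term (fun v : nat -> R => v i).
Proof. by exists (GRing.Var R i). Qed.

Lemma definable_term_const (R : realType) (a : R) :
  definable_term (fun _ : nat -> R => a).
Proof. by exists (GRing.Const a). Qed.

Lemma definable_termD (R : realType) (F G : (nat -> R) -> R) : definable_term F ->
  definable_term G -> definable_term (fun v : nat -> R => F v + G v).
Proof. by move=> [s sF] [t tG]; exists (GRing.Add s t) => e /=; rewrite sF tG. Qed.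

Lemma definable_termN (R : realType) (F : (nat -> R) -> R) : definable_term F ->
  definable_term (fun v : nat -> R => - F v).
Proof. by move=> [s sF]; exists (GRing.Opp s) => e /=; rewrite sF. Qed.

Lemma definable_termM (R : realType) (F G : (nat -> R) -> R) : definable_term F ->
  definable_term G -> definable_term (fun v : nat -> R => F v * G v).
Proof. by move=> [s sF] [t tG]; exists (GRing.Mul s t) => e /=; rewrite sF tG. Qed.

Lemma definable_termX (R : realType) (F : (nat -> R) -> R) k : definable_term F ->
  definable_term (fun v : nat -> R => F v ^+ k).
Proof. by move=> [s sF]; exists (GRing.Exp s k) => e /=; rewrite sF. Qed.

Lemma definable_term_sum (R : realType) I (s : seq I)
    (F : I -> (nat -> R) -> R) : (forall i, definable_term (F i)) ->
  definable_term (fun v : nat -> R => \sum_(i <- s) F i v).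
Proof.
move=> defF; elim: s => [|i s IH].
  by have [t tE] := @definable_term_const R 0; exists t => e; rewrite big_nil tE.
have [t tE] := definable_termD (defF i) IH.
by exists t => e; rewrite big_cons tE.
Qed.

Lemma definable_term_prod (R : realType) I (s : seq I)
    (F : I -> (nat -> R) -> R) : (forall i, definable_term (F i)) ->
  definable_term (fun v : nat -> R => \prod_(i <- s) F i v).
Proof.
move=> defF; elim: s => [|i s IH].
  by have [t tE] := @definable_term_const R 1; exists t => e; rewrite big_nil tE.
have [t tE] := definable_termM (defF i) IH.
by exists t => e; rewrite big_cons tE.
Qed.

Lemma definable_meval (R : realType) (n : nat) (p : mpoly.mpoly n R)
    (idx : 'I_n -> nat) :
  definable_term (fun v : nat -> R => mpoly.meval (fun i => v (idx i)) p).
Proof.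
under eq_fun do rewrite mpoly.mevalE.
apply: definable_term_sum => m; apply: definable_termM.
  exact: definable_term_const.
by apply: definable_term_prod => i; apply/definable_termX/definable_term_var.
Qed.

Lemma definable_bool (R : realType) (b : bool) : definable (fun _ : nat -> R => b).
Proof. by exists (ord.Bool b). Qed.

Lemma definable_eq0 (R : realType) (F : (nat -> R) -> R) : definable_term F ->
  definable (fun v : nat -> R => F v == 0).
Proof.
move=> [t tF]; exists (ord.Equal t (GRing.Const 0)) => e /=.
by rewrite tF; split=> [->|/eqP].
Qed.

Lemma definable_gt0 (R : realType) (F : (nat -> R) -> R) : definable_term F ->
  definable (fun v : nat -> R => 0 < F v).
Proof. by move=> [t tF]; exists (ord.Lt (GRing.Const 0) t) => e /=; rewrite tF. Qed.

Lemma definable_and (R : realType) (P Q : (nat -> R) -> Prop) :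
  definable P -> definable Q -> definable (fun v : nat -> R => P v /\ Q v).
Proof.
by move=> [f fP] [g gQ]; exists (ord.And f g) => e /=; rewrite fP gQ.
Qed.

Lemma definable_or (R : realType) (P Q : (nat -> R) -> Prop) :
  definable P -> definable Q -> definable (fun v : nat -> R => P v \/ Q v).
Proof.
by move=> [f fP] [g gQ]; exists (ord.Or f g) => e /=; rewrite fP gQ.
Qed.

Lemma definable_not (R : realType) (P : (nat -> R) -> Prop) : definable P ->
  definable (fun v : nat -> R => ~ P v).
Proof. by move=> [f fP]; exists (ord.Not f) => e /=; rewrite fP. Qed.

Lemma definable_ext (R : realType) (P Q : (nat -> R) -> Prop) : definable P ->
  (forall v, P v <-> Q v) -> definable Q.
Proof. by move=> [f fP] PQ; exists f => e; rewrite fP. Qed.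

Lemma definable_all (R : realType) (T : Type) (s : seq T)
    (P : T -> (nat -> R) -> bool) :
  (forall x, definable (P x)) -> definable (fun v : nat -> R => all (P^~ v) s).
Proof.
move=> defP; elim: s => [|x s IH] /=; first exact: definable_bool.
apply: definable_ext (definable_and (defP x) IH) _ => v.
by split=> /andP.
Qed.

Lemma definable_has (R : realType) (T : Type) (s : seq T)
    (P : T -> (nat -> R) -> bool) :
  (forall x, definable (P x)) -> definable (fun v : nat -> R => has (P^~ v) s).
Proof.
move=> defP; elim: s => [|x s IH] /=; first exact: definable_bool.
apply: definable_ext (definable_or (defP x) IH) _ => v.
by split=> /orP.
Qed.

Lemma definable_semialgebraic (R : realType) (n : nat) (A : set 'rV[R]_n)
    (idx : 'I_n -> nat) : semialgebraic_set A ->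
  definable (fun v : nat -> R => A (\row_i v (idx i))).
Proof.
move=> [F ->] /=.
have evalE v p : mpoly.meval ((\row_i (v (idx i) : R)) ord0) p =
    mpoly.meval (fun i => v (idx i)) p.
  by apply: mpoly.meval_eq => i; rewrite mxE.
apply: definable_has => -[eqs pos] /=.
apply: definable_ext; last by move=> v; apply: rwP; exact: andP.
apply: definable_and.
  apply: definable_all => p; apply: definable_eq0.
  by under eq_fun do rewrite evalE; exact: definable_meval.
apply: definable_all => p; apply: definable_gt0.
by under eq_fun do rewrite evalE; exact: definable_meval.
Qed.

Definition overwrite (R : Type) (a n : nat) (w v : nat -> R) : nat -> R :=
  fun j => if (a <= j < a + n)%N then w j else v j.

(** A block of variables is quantified at once by letting a single function
    supply its values; only the values of this function on the block matter. *)
Lemma definable_exists_block (R : realType) (a n : nat)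
    (P : (nat -> R) -> Prop) : definable P ->
  definable (fun v : nat -> R => exists w, P (overwrite a n w v)).
Proof.
elim: n P => [|n IH] P defP.
  apply: definable_ext defP _ => v.
  have E w : overwrite a 0 w v = v.
    by apply/funext => j; rewrite /overwrite addn0 ltnNge andbN.
  by split=> [Pv|[w]]; [exists v|]; rewrite E.
have [f fP] := IH _ defP.
exists (ord.Exists (a + n) f) => e /=.
have E x w : overwrite a n w (nth 0 (set_nth 0 e (a + n) x)) =
    overwrite a n.+1 (fun j => if j == (a + n)%N then x else w j) (nth 0 e).
  apply/funext => j; rewrite /overwrite nth_set_nth /=.
  by case: eqP => [->|/eqP neq]; rewrite addnS ltnS ?ltnn ?leqnn ?leq_addr //=
     ltn_neqAle neq.
split=> [[x /fP[w]]|[w Pw]].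
  by rewrite E => Px; exists (fun j => if j == (a + n)%N then x else w j).
exists (w (a + n)%N); apply/fP; exists w; rewrite E.
by congr (P (overwrite _ _ _ _)): Pw; apply/funext => j; case: eqP => // ->.
Qed.

(** The coordinates of [x] are stored in the variables from [a] on.  The locality
    hypothesis says that [Q x] only reads the variables below [a], so that
    storing [x] does not alter the meaning of [Q]. *)
Lemma definable_exists_row (R : realType) (a n : nat)
    (Q : 'rV[R]_n -> (nat -> R) -> Prop) :
  definable (fun v : nat -> R => Q (\row_i v (a + i)%N) v) ->
  (forall x v v', (forall j, (j < a)%N -> v j = v' j) -> Q x v -> Q x v') ->
  definable (fun v : nat -> R => exists x, Q x v).
Proof.
move=> defQ locQ; apply: definable_ext (definable_exists_block a n defQ) _.
move=> v; split=> [[w Qw]|[x Qx]].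
  exists (\row_i overwrite a n w v (a + i)); apply: locQ Qw => j ja.
  by rewrite /overwrite leqNgt ja.
exists (fun j => oapp (x ord0) 0 (insub (j - a)%N)).
have -> : \row_i overwrite a n (fun j => oapp (x ord0) 0 (insub (j - a)%N)) v
    (a + i)%N = x.
  apply/rowP => i; rewrite mxE /overwrite leq_addr ltn_add2l ltn_ord /=.
  by rewrite addKn valK.
by apply: locQ Qx => j ja; rewrite /overwrite leqNgt ja.
Qed.

(** * Quantifier elimination *)

(** Variable 0 becomes the outer variable of [p] and variable 1 the inner one;
    the sequence [[:: a; b]] assigns 0 to all the others. *)
Lemma rterm_bipoly (R : realType) (t : GRing.term R) : GRing.rterm t ->
  exists p : {poly {poly R}}, forall a b, GRing.eval [:: a; b] t = p.[a, b].
Proof.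
elim: t => //=.
- move=> [|[|i]] _.
  + by exists 'X => a b; rewrite !hornerE.
  + by exists ('X%:P) => a b; rewrite !hornerE.
  + by exists 0 => a b; rewrite /= nth_nil !hornerE.
- by move=> x _; exists (x%:P%:P) => a b; rewrite !hornerE.
- by move=> k _; exists (k%:R%:P%:P) => a b; rewrite !hornerE.
- move=> s IHs t IHt /andP[/IHs[p pE] /IHt[q qE]].
  by exists (p + q) => a b; rewrite pE qE !hornerE.
- by move=> s IHs /IHs[p pE]; exists (- p) => a b; rewrite pE !hornerE.
- move=> s IHs k /IHs[p pE]; exists (p *+ k) => a b.
  by rewrite pE !hornerMn.
- move=> s IHs t IHt /andP[/IHs[p pE] /IHt[q qE]].
  by exists (p * q) => a b; rewrite pE qE !hornerE.
- move=> s IHs k /IHs[p pE]; exists (p ^+ k) => a b.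
  by rewrite pE !horner_exp.
Qed.

Lemma qf_same_signs (R : realType) (f : ord.formula R) :
  ord.qf_form f -> ord.rformula f ->
  exists ps, forall t1 t2 r, same_signs ps t1 t2 r ->
    ord.qf_eval [:: t1; r] f = ord.qf_eval [:: t2; r] f.
Proof.
have atom s t : GRing.rterm s && GRing.rterm t ->
    exists p : {poly {poly R}}, forall a b,
      GRing.eval [:: a; b] s - GRing.eval [:: a; b] t = p.[a, b].
  move=> /andP[/rterm_bipoly[p pE] /rterm_bipoly[q qE]].
  by exists (p - q) => a b; rewrite pE qE !hornerE.
have binary ps qs t1 t2 r : same_signs (ps ++ qs) t1 t2 r ->
    same_signs ps t1 t2 r /\ same_signs qs t1 t2 r.
  by move=> H; split=> p pin; apply: H; rewrite mem_cat pin ?orbT.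
elim: f => //=.
- by move=> b _ _; exists [::].
- move=> s t _ /atom[p pE]; exists [:: p] => t1 t2 r /(_ p (mem_head _ _)) H.
  by rewrite -subr_eq0 -[RHS]subr_eq0 !pE -sgr_eq0 H sgr_eq0.
- move=> s t _ /atom[p pE]; exists [:: p] => t1 t2 r /(_ p (mem_head _ _)) H.
  by rewrite -subr_lt0 -[RHS]subr_lt0 !pE -sgr_lt0 H sgr_lt0.
- move=> s t _ /atom[p pE]; exists [:: p] => t1 t2 r /(_ p (mem_head _ _)) H.
  by rewrite -subr_le0 -[RHS]subr_le0 !pE -sgr_le0 H sgr_le0.
- move=> f IHf g IHg /andP[qf qg] /andP[/(IHf qf)[ps psE] /(IHg qg)[qs qsE]].
  by exists (ps ++ qs) => t1 t2 r /binary[/psE -> /qsE ->].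
- move=> f IHf g IHg /andP[qf qg] /andP[/(IHf qf)[ps psE] /(IHg qg)[qs qsE]].
  by exists (ps ++ qs) => t1 t2 r /binary[/psE -> /qsE ->].
- move=> f IHf g IHg /andP[qf qg] /andP[/(IHf qf)[ps psE] /(IHg qg)[qs qsE]].
  by exists (ps ++ qs) => t1 t2 r /binary[/psE -> /qsE ->].
- by move=> f IHf qf /(IHf qf)[ps psE]; exists ps => t1 t2 r /psE ->.
Qed.

(** Quantifier elimination turns [P] into a Boolean combination of sign
    conditions on finitely many polynomials.  The zero polynomial has constant
    sign, so it can be left out of the family. *)
Lemma definable_same_signs (R : realType) (P : (nat -> R) -> Prop) :
  definable P ->
  exists2 ps : seq {poly {poly R}}, forall p, p \in ps -> p != 0 &
    forall t1 t2 r, same_signs ps t1 t2 r ->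
      P (nth 0 [:: t1; r]) -> P (nth 0 [:: t2; r]).
Proof.
move=> [f fP].
have rf := ord.to_rform_rformula f.
have /andP[qg rg] := ord.quantifier_elim_wf (@qe_rcf.wf_QE_wproj R) rf.
have [ps psE] := qf_same_signs qg rg.
exists [seq p <- ps | p != 0] => [p|t1 t2 r H].
  by rewrite mem_filter => /andP[].
have holdsP e := ord.quantifier_elim_rformP
  (@qe_rcf.wf_QE_wproj R) (@qe_rcf.valid_QE_wproj R) e rf.
rewrite -2!fP => /ord.to_rformP/holdsP Pt1; apply/ord.to_rformP/holdsP.
rewrite -(psE t1) // => p pps; have [->|p0] := eqVneq p 0.
  by rewrite !horner0.
by apply: H; rewrite mem_filter p0.
Qed.

(** * The Hölderian error bound *)

Lemma enorm_ge0 (R : realType) (n : nat) (x : 'rV[R]_n) : 0 <= enorm x.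
Proof. exact: sqrtr_ge0. Qed.

Lemma dist_has_lbound (R : realType) (n : nat) (x : 'rV[R]_n)
    (S : set 'rV[R]_n) : has_lbound [set enorm (x - y) | y in S].
Proof. by exists 0 => _ [y _ <-]; exact: enorm_ge0. Qed.

Lemma dist_le (R : realType) (n : nat) (x y : 'rV[R]_n) (S : set 'rV[R]_n) :
  S y -> dist x S <= enorm (x - y).
Proof. by move=> Sy; apply: (ge_inf (dist_has_lbound _ _)); exists y. Qed.

Lemma le_dist (R : realType) (n : nat) (x : 'rV[R]_n) (S : set 'rV[R]_n)
    (r : R) : S !=set0 -> (forall y, S y -> r <= enorm (x - y)) -> r <= dist x S.
Proof.
move=> [y Sy] rS; apply: lb_le_inf; first by exists (enorm (x - y)), y.
by move=> _ [z Sz <-]; exact: rS.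
Qed.

Lemma le_enorm (R : realType) (n : nat) (x : 'rV[R]_n) (r : R) : 0 <= r ->
  (r <= enorm x) = (r ^+ 2 <= \sum_(i < n) x ord0 i ^+ 2).
Proof.
move=> r0; rewrite /enorm -{1}(ger0_norm r0) -sqrtr_sqr ler_sqrt //.
by apply: sumr_ge0 => i _; exact: sqr_ge0.
Qed.

Definition far_values (R : realType) (n : nat) (X S : set 'rV[R]_n)
    (psi : 'rV[R]_n -> R) (r : R) : set R :=
  [set psi x | x in [set x | X x /\ forall y, S y -> r <= enorm (x - y)]].

Lemma graphP (R : realType) (n : nat) (psi : 'rV[R]_n -> R) x (t : R) :
  graph psi (row_mx x t%:M) <-> psi x = t.
Proof.
split=> [[y _ /eq_row_mx[-> /matrixP/(_ 0 0)]]|<-]; last by exists x.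
by rewrite !mxE.
Qed.

(** Variables 0 and 1 hold [t] and [r]; the vector [x] is stored from variable 2
    on, and the vector [y] after it.  The condition [0 <= r] allows distances to
    be compared through their squares, which are polynomials. *)
Lemma definable_far_values (R : realType) (n : nat) (X S : set 'rV[R]_n)
    (psi : 'rV[R]_n -> R) :
  semialgebraic_set X -> semialgebraic_set S -> semialgebraic_fun psi ->
  definable (fun v : nat -> R => 0 <= v 1%N /\ far_values X S psi (v 1%N) (v 0%N)).
Proof.
move=> saX saS sapsi.
pose close (x y : 'rV[R]_n) (r : R) :=
  0 < r ^+ 2 - \sum_(i < n) (x ord0 i - y ord0 i) ^+ 2.
have defclose : definable (fun v : nat -> R => exists x, (X x /\ psi x = v 0%N) /\
    ~ exists y, S y /\ close x y (v 1%N)).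
  apply: (@definable_exists_row _ 2); last first.
    by move=> x v v' vv'; rewrite !vv'.
  apply: definable_and; first apply: definable_and.
  - exact: definable_semialgebraic.
  - pose idx (i : 'I_(n + 1)) : nat :=
      if fintype.split i is inl j then (2 + j)%N else 0%N.
    apply: definable_ext (definable_semialgebraic idx sapsi) _ => v.
    rewrite -graphP; suff -> : \row_i v (idx i) =
      row_mx (\row_i v (2 + i)%N) (v 0%N)%:M by [].
    apply/rowP => i; rewrite !mxE /idx.
    by case: (fintype.split i) => j; rewrite !mxE // ord1 eqxx.
  - apply/definable_not/(@definable_exists_row _ (2 + n)).
      apply: definable_and; first exact: definable_semialgebraic.
      apply: definable_gt0; apply: definable_termD.
        exact/definable_termX/definable_term_var.
      apply/definable_termN/definable_term_sum => i.
      under eq_fun do rewrite !mxE.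
      by apply/definable_termX/definable_termD; [|apply: definable_termN];
         exact: definable_term_var.
    move=> y v v' vv' [Sy closev]; split=> //.
    have -> : \row_i v' (2 + i)%N = \row_i v (2 + i)%N :> 'rV[R]_n.
      by apply/rowP => i; rewrite !mxE vv' // ltn_add2l.
    by rewrite -vv'.
have defle : definable (fun v : nat -> R => ~ (0 < - v 1%N)).
  by apply/definable_not/definable_gt0/definable_termN/definable_term_var.
apply: definable_ext (definable_and defle defclose) _ => v.
have sumE (x y : 'rV[R]_n) : \sum_(i < n) (x ord0 i - y ord0 i) ^+ 2 =
    \sum_(i < n) (x - y) ord0 i ^+ 2.
  by apply: eq_bigr => i _; rewrite !mxE.
have -> : (~ 0 < - v 1%N) = (0 <= v 1%N) :> Prop.
  by rewrite oppr_gt0 leNgt; apply/propext; split=> /negP.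
split=> [[v1 [x [[Xx <-] far]]]|[v1 [x [Xx far] <-]]]; split=> //.
  exists x => //; split=> // y Sy; rewrite le_enorm // leNgt; apply/negP => lt_y.
  apply: far; exists y; split=> //; rewrite /close subr_gt0.
  by rewrite sumE.
exists x; split=> // -[y [Sy]]; rewrite /close subr_gt0 ltNge => /negP; apply.
by rewrite sumE -le_enorm // far.
Qed.

(** The infimum of [psi] over the points of [X] at distance at least [r] from
    [S] is positive by the hypothesis on sequences; together with [r] it is a
    point of one of finitely many algebraic curves, each of which stays above a
    multiple of a power of [r]. *)
Lemma residual_lower_bound (R : realType) (n : nat) (X S : set 'rV[R]_n)
    (psi : 'rV[R]_n -> R) : S !=set0 ->
  semialgebraic_set X -> semialgebraic_set S -> semialgebraic_fun psi ->
  (forall x, 0 <= psi x) ->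
  (forall x_ : nat -> 'rV[R]_n, (forall k, X (x_ k)) ->
     psi (x_ k) @[k --> \oo] --> (0 : R) ->
     dist (x_ k) S @[k --> \oo] --> (0 : R)) ->
  exists (c : R) (m : nat) (d : R), [/\ 0 < c, 0 < d <= 1 &
    forall x r, X x -> 0 < r < d -> r <= dist x S -> c * r ^+ m <= psi x].
Proof.
move=> S0 saX saS sapsi psi0 A1.
have [ps ps0 signs] :=
  definable_same_signs (definable_far_values saX saS sapsi).
have [c [m [d [c0 d01 lb]]]] := curves_lower_bound ps0.
exists c, m, d; split=> // x r Xx /andP[r0 rd] rx.
set A := far_values X S psi r.
have Ax : A (psi x).
  by exists x => //; split=> // y Sy; exact: le_trans rx (dist_le _ Sy).
have lbA : lbound A 0 by move=> _ [y _ <-].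
have [|||p pps p0] := @inf_root _ ps r A.
- by exists (psi x).
- by exists 0.
- move=> t1 t2 same At1.
  by have [|] := signs t1 t2 r same; first by split=> //=; exact: ltW.
have Ainf : inf A <= psi x by apply: ge_inf => //; exists 0.
apply: le_trans Ainf; apply: (lb p) => //; last by rewrite r0.
rewrite lt_neqAle lb_le_inf ?andbT //; last by exists (psi x).
apply/eqP => inf0.
have /choice[x_ x_P] : forall k : nat, exists y : 'rV[R]_n,
    [/\ X y, psi y < k.+1%:R^-1 & r <= dist y S].
  move=> k; have [||_ [y [Xy far] <-]] := @inf_adherent _ A k.+1%:R^-1.
  - by rewrite invr_gt0 ltr0n.
  - by split; [exists (psi x)|exists 0].
  by rewrite -inf0 add0r => lt_y; exists y; split=> //; exact: le_dist.
have psi_cvg : psi (x_ k) @[k --> \oo] --> (0 : R).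
  apply: (squeeze_cvgr _ (cvg_cst 0) cvg_harmonic).
  by near=> k; rewrite psi0 /=; case: (x_P k) => _ /ltW.
have := A1 x_ (fun k => let: And3 Xk _ _ := x_P k in Xk) psi_cvg.
move=> /cvgr_lt/(_ r r0) [N _ /(_ N (leqnn N))] /=.
by case: (x_P N) => _ _; rewrite leNgt => /negP.
Unshelve. all: by end_near. Qed.

(** The lower bound on [psi] holds for small distances only, but [psi] need only
    be compared with the scaled distance [s * dist x S], where [s] is chosen such
    that all scaled distances are small. *)
Lemma holder_error_bound (R : realType) (n : nat) (X S : set 'rV[R]_n)
    (psi : 'rV[R]_n -> R) : S !=set0 ->
  semialgebraic_set X -> semialgebraic_set S -> semialgebraic_fun psi ->
  (forall x, 0 <= psi x) ->
  (forall x_ : nat -> 'rV[R]_n, (forall k, X (x_ k)) ->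
     psi (x_ k) @[k --> \oo] --> (0 : R) ->
     dist (x_ k) S @[k --> \oo] --> (0 : R)) ->
  (exists M : R, forall x, X x -> dist x S <= M) ->
  exists C alpha : R, [/\ 0 < C, 0 < alpha <= 1 &
    forall x, X x -> dist x S <= C * psi x `^ alpha].
Proof.
move=> S0 saX saS sapsi psi0 A1 [M0 XM0].
have [c [m [d [c0 /andP[d0 d1] lb]]]] :=
  residual_lower_bound S0 saX saS sapsi psi0 A1.
pose M := Num.max 1 M0.
have M1 : 1 <= M by rewrite le_max lexx.
have XM x : X x -> dist x S <= M by move=> /XM0; rewrite le_max => ->; rewrite orbT.
have Mgt0 : 0 < M by lra.
pose s := d / (2 * M).
have s0 : 0 < s by rewrite divr_gt0 // mulr_gt0.
have sM : s * M < d by rewrite /s invfM mulrA mulfVK ?gt_eqF //; lra.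
have s1 : s <= 1 by nra.
(* The exponent [m] may be 0; [m + 1] can replace it because scaled distances
   are less than 1. *)
pose K := (c * s ^+ m.+1)^-1.
have K0 : 0 < K by rewrite invr_gt0 mulr_gt0 ?exprn_gt0.
exists (K `^ m.+1%:R^-1), m.+1%:R^-1; split.
- by rewrite powR_gt0.
- by rewrite invr_gt0 ltr0n invf_le1 ?ler1n ?ltr0n.
move=> x Xx; have D0 : 0 <= dist x S by apply: le_dist => // y _; exact: enorm_ge0.
move: D0; rewrite le_eqVlt => /predU1P[<-|D0].
  by rewrite mulr_ge0 ?powR_ge0.
rewrite -powRM ?(ltW K0) //.
have -> : dist x S = (dist x S ^+ m.+1) `^ m.+1%:R^-1.
  by rewrite -powR_mulrn ?(ltW D0) // -powRrM mulfV ?pnatr_eq0 // powRr1 ?ltW.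
apply: ge0_ler_powR; rewrite ?nnegrE ?invr_ge0 ?ler0n ?exprn_ge0 ?(ltW D0) //.
  by rewrite mulr_ge0 ?(ltW K0).
rewrite mulrC ler_pdivlMr; last by rewrite mulr_gt0 ?exprn_gt0.
have sD0 : 0 < s * dist x S by rewrite mulr_gt0.
have DM := XM x Xx.
have sDd : s * dist x S < d by nra.
have sDle : s * dist x S <= dist x S by nra.
have := lb x _ Xx (introT andP (conj sD0 sDd)) sDle.
apply: le_trans; rewrite mulrCA ler_pM2l // mulrC -exprMn exprS.
by rewrite ger_pMl ?exprn_gt0 //; lra.
Qed.

(** * Exact penalization *)

(** The Lipschitz bound compares [f x] with the values of [f] at points of [S]
    nearly as close to [x] as possible, which gives
    [inf_S f <= f x + L * dist x S <= f x + c * g x].  At a minimizer of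
    [f + c' * g], the value [f x + c' * g x] is at most [f x + c * g x], which for
    [c < c'] forces [g x = 0]. *)
Lemma exact_penalty (R : realType) (n : nat) (X S : set 'rV[R]_n)
    (f g : 'rV[R]_n -> R) (L c : R) :
  S `<=` X -> S !=set0 -> inf_on S f \is a fin_num ->
  0 < L -> (forall x y, X x -> X y -> `|f x - f y| <= L * enorm (x - y)) ->
  (forall x, 0 <= g x) -> (forall x, g x = 0 <-> S x) ->
  (forall x, X x -> L * dist x S <= c * g x) ->
  forall c', c < c' ->
    inf_on S f = inf_on X (fun x => f x + c' * g x) /\
    argmin_on S f = argmin_on X (fun x => f x + c' * g x).
Proof.
move=> SX S0 finf L0 lipf g0 gS errb c' cc'.
have inf_le x : X x -> fine (inf_on S f) <= f x + c * g x.
  move=> Xx; rewrite -lerBlDl; apply: le_trans (errb x Xx).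
  rewrite mulrC -ler_pdivrMr //; apply: le_dist => // y Sy.
  rewrite ler_pdivrMr // mulrC lerBlDl.
  have fy : fine (inf_on S f) <= f y.
    by rewrite -lee_fin fineK //; apply: ereal_inf_lbound; exists y.
  have := lipf y x (SX y Sy) Xx; have := ler_norm (f y - f x).
  have -> : enorm (y - x) = enorm (x - y).
    congr (Num.sqrt _); apply: eq_bigr => i _.
    by rewrite -opprB mxE sqrrN.
  by move: fy; lra.
have infE : inf_on S f = inf_on X (fun x => f x + c' * g x).
  apply/eqP; rewrite eq_le; apply/andP; split.
    apply: le_ereal_inf_tmp => _ [x Xx <-]; rewrite -(fineK finf) lee_fin.
    by apply: le_trans (inf_le x Xx) _; rewrite lerD2l ler_wpM2r // ltW.
  apply: ereal_inf_le_tmp => _ [x Sx <-]; exists x; first exact: SX.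
  by have /gS -> := Sx; rewrite mulr0 addr0.
split=> //; apply/seteqP; split=> x [].
  move=> Sx fx; split; first exact: SX.
  by have /gS -> := Sx; rewrite mulr0 addr0 fx.
rewrite -infE => Xx fx.
have cc0 : 0 < c' - c by rewrite subr_gt0.
have gx : g x = 0.
  have := inf_le x Xx; rewrite -fx /= lerD2l => gle.
  apply/eqP; rewrite eq_le g0 andbT -(pmulr_rle0 (g x) cc0).
  by rewrite mulrBl subr_le0.
split; first exact/gS.
by rewrite -fx gx mulr0 addr0.
Qed.

Theorem theorem5p4 (R : realType) (n : nat) (X S : set 'rV[R]_n)
    (f0 psi : 'rV[R]_n -> R)
    (SX : S `<=` X) (X0 : X !=set0) (S0 : S !=set0)
    (saX : semialgebraic_set X) (saS : semialgebraic_set S)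
    (lip_f0 : elipschitz_on X f0)
    (fin_f0 : inf_on S f0 \is a fin_num)
    (sa_psi : semialgebraic_fun psi) (res_psi : residual_fun S psi)
    (A1 : forall x_ : nat -> 'rV[R]_n, (forall k, X (x_ k)) ->
       psi (x_ k) @[k --> \oo] --> (0 : R) ->
       dist (x_ k) S @[k --> \oo] --> (0 : R))
    (A2 : exists M : R, forall x, X x -> dist x S <= M) :
  exists c_star alpha : R,
    [/\ 0 < c_star, 0 < alpha <= 1 &
      forall c : R, c_star < c ->
        inf_on S f0 = inf_on X (fun x => f0 x + c * psi x `^ alpha) /\
        argmin_on S f0 = argmin_on X (fun x => f0 x + c * psi x `^ alpha)].
Proof.
have [psi_ge0 psi0] := res_psi; have [L L0 lipL] := lip_f0.
have [C [alpha [C0 /andP[a0 a1] errb]]] :=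
  holder_error_bound S0 saX saS sa_psi psi_ge0 A1 A2.
exists (L * C), alpha; split; rewrite ?mulr_gt0 ?a0 //.
apply: (@exact_penalty _ _ _ _ _ _ L) => // [x|x|x Xx].
- exact: powR_ge0.
- rewrite -psi0; split=> [/eqP|->]; last by rewrite powR0 ?gt_eqF.
  by rewrite powR_eq0 => /andP[/eqP].
- by rewrite -mulrA ler_pM2l ?errb.
Qed.
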